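(* Let $\alpha\in\mathbb{F}_q((z^{-1}))$ be irrational and let $(P_k/Q_k)_{k\ge1}$ be the sequence of its convergents. Then $\alpha$ is singular on average if and only if $\|Q_k\|^{1/k}\to\infty$ as $k\to\infty$.
   Context: Let $q$ be a prime power, $\mathbb{F}_q[z]$ the polynomial ring over $\mathbb{F}_q$, $\mathbb{F}_q((z^{-1}))$ the field of formal Laurent series $x=\sum_{i\ge-N}a_iz^{-i}$, with $\|x\|=q^{\deg x}$ for $x\ne0$, $\|0\|=0$; irrational means not in $\mathbb{F}_q(z)$; the fractional part is $\{x\}=\sum_{i\ge1}a_iz^{-i}$. Continued fraction: $\alpha=A_0+1/(A_1+1/(A_2+\cdots))$, $A_i\in\mathbb{F}_q[z]$, $\deg A_i\ge1$ for $i\ge1$; $Q_{-1}=0$, $Q_0=1$, $Q_{k+1}=A_{k+1}Q_k+Q_{k-1}$ (and $P_k$ analogously with $P_{-1}=1$, $P_0=A_0$). For $c>0$, $N\ge1$, $\Delta_{N,c}(\alpha)$ is the number of integers $l\in\{1,\dots,N\}$ for which $\|\{Q\alpha\}\|\le c2^{-l}$ has a solution $Q\in\mathbb{F}_q[z]$ with $0<\|Q\|\le2^l$; $\alpha$ is singular on average if $\lim_{N\to\infty}\Delta_{N,c}(\alpha)/N=1$ for every $c>0$. *)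

(* Defs.v *)
From HB Require Import structures.
From mathcomp Require Import all_boot all_order all_algebra.
From mathcomp Require Import all_classical all_reals all_analysis.
From mathcomp Require Import zify ring.

Set Implicit Arguments.
Unset Strict Implicit.
Unset Printing Implicit Defensive.

Import Order.TTheory GRing.Theory Num.Theory.
Import numFieldNormedType.Exports.

Local Open Scope classical_set_scope.
Local Open Scope ring_scope.

Definition vanish_above (F : fieldType) (f : int -> F) (N : int) :=
  forall i : int, N < i -> f i = 0.

(* [x i] is the coefficient of z^i in x: in the notation
   x = \sum_(i >= -N) a_i z^(-i), it is a_(-i). *)
Record laurent (F : fieldType) := Laurent {
  lcoef :> int -> F;
  laurent_bounded : exists N : int, vanish_above lcoef N }.

Section LaurentField.
Variable F : fieldType.
Implicit Types (f g h : int -> F) (x y : laurent F) (N M : int).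

Lemma laurentP x y : lcoef x =1 lcoef y -> x = y.
Proof.
case: x y => [f f0] [g g0] /= /funext fg; rewrite {}fg in f0 *.
by rewrite (Prop_irrelevance f0 g0).
Qed.

HB.instance Definition _ := gen_eqMixin (laurent F).
HB.instance Definition _ := gen_choiceMixin (laurent F).

Lemma vanish_aboveW f N M : N <= M -> vanish_above f N -> vanish_above f M.
Proof. by move=> NM f0 i Mi; apply: f0; apply: le_lt_trans Mi. Qed.

Lemma laurent_bounded2 x y : exists N, vanish_above x N /\ vanish_above y N.
Proof.
have [[N x0] [M y0]] := (laurent_bounded x, laurent_bounded y).
exists (Num.max N M); split.
  by apply: vanish_aboveW x0; rewrite le_max lexx.
by apply: vanish_aboveW y0; rewrite le_max lexx orbT.
Qed.

Lemma lzero_subproof : exists N, vanish_above (fun=> 0 : F) N.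
Proof. by exists 0. Qed.
Definition lzero := Laurent lzero_subproof.

Lemma lopp_subproof x : exists N, vanish_above (fun i => - x i) N.
Proof.
by have [N x0] := laurent_bounded x; exists N => i Ni; rewrite x0 ?oppr0.
Qed.
Definition lopp x := Laurent (lopp_subproof x).

Lemma ladd_subproof x y : exists N, vanish_above (fun i => x i + y i) N.
Proof.
have [N [x0 y0]] := laurent_bounded2 x y.
by exists N => i Ni; rewrite x0 ?y0 ?addr0.
Qed.
Definition ladd x y := Laurent (ladd_subproof x y).

Lemma laddA : associative ladd.
Proof. by move=> x y z; apply: laurentP => i /=; rewrite addrA. Qed.
Lemma laddC : commutative ladd.
Proof. by move=> x y; apply: laurentP => i /=; rewrite addrC. Qed.
Lemma ladd0 : left_id lzero ladd.
Proof. by move=> x; apply: laurentP => i /=; rewrite add0r. Qed.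
Lemma laddN : left_inverse lzero lopp ladd.
Proof. by move=> x; apply: laurentP => i /=; rewrite addNr. Qed.

HB.instance Definition _ :=
  GRing.isZmodule.Build (laurent F) laddA laddC ladd0 laddN.

(* The sum has finite support when f and g vanish above some bound. *)
Definition lconv f g (n : int) : F := \sum_(i \in [set: int]) (f i * g (n - i)).

Lemma fsum_int_ord (G : int -> F) (h : nat -> int) m :
  injective h -> (forall i, (forall k, (k < m)%N -> h k != i) -> G i = 0) ->
  \sum_(i \in [set: int]) G i = \sum_(k < m) G (h k).
Proof.
move=> hinj G0; rewrite (fsbigE [seq h k | k <- iota 0 m]) //.
- under eq_bigl do rewrite in_setT.
  by rewrite big_map -{1}[m]subn0 -/(index_iota 0 m) big_mkord.
- by rewrite map_inj_uniq ?iota_uniq.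
- move=> i _ /mapP iNh; apply: G0 => k km; apply/eqP => hki.
  by apply: iNh; exists k; rewrite // mem_iota.
Qed.

Definition trunc f N n : {poly F} := \poly_(i < n.+1) f (N - i%:Z).

Lemma coef_trunc f N n k : (k <= n)%N -> (trunc f N n)`_k = f (N - k%:Z).
Proof. by move=> kn; rewrite coef_poly ltnS kn. Qed.

Lemma vanish_lconv f g N M : vanish_above f N -> vanish_above g M ->
  vanish_above (lconv f g) (N + M).
Proof.
move=> f0 g0 n NMn; rewrite /lconv fsbig1 // => i _.
have [Ni|iN] := ltP N i; first by rewrite f0 ?mul0r.
by rewrite g0 ?mulr0 //; lia.
Qed.

Lemma lconv_trunc f g N M n k : vanish_above f N -> vanish_above g M ->
  (k <= n)%N -> lconv f g (N + M - k%:Z) = (trunc f N n * trunc g M n)`_k.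
Proof.
move=> f0 g0 kn; rewrite coefM /lconv.
rewrite (@fsum_int_ord _ (fun j : nat => N - j%:Z) k.+1); first last.
- move=> i iNh; have [Ni|iN] := ltP N i; first by rewrite f0 ?mul0r.
  rewrite g0 ?mulr0 //; rewrite ltNge; apply/negP => le.
  by have /negP := iNh `|N - i|%N ltac:(lia); apply; apply/eqP; lia.
- by move=> i j; lia.
apply: eq_bigr => j _; have jk : (j <= k)%N by rewrite -ltnS.
rewrite !coef_trunc ?(leq_trans jk) ?(leq_trans (leq_subr _ _)) //.
by congr (_ * g _); lia.
Qed.

Lemma lmul_subproof x y : exists N, vanish_above (lconv x y) N.
Proof.
have [N [x0 y0]] := laurent_bounded2 x y.
by exists (N + N); apply: vanish_lconv.
Qed.
Definition lmul x y := Laurent (lmul_subproof x y).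

Lemma lone_subproof : exists N, vanish_above (fun i => (i == 0)%:R : F) N.
Proof. by exists 0 => i i0; rewrite gt_eqF. Qed.
Definition lone := Laurent lone_subproof.

Lemma laurent_eq_below x y N : vanish_above x N -> vanish_above y N ->
  (forall k : nat, x (N - k%:Z) = y (N - k%:Z)) -> x = y.
Proof.
move=> x0 y0 xy; apply: laurentP => i.
have [Ni|iN] := ltP N i; first by rewrite x0 ?y0.
by have := xy `|N - i|%N; congr (x _ = y _); lia.
Qed.

Lemma coefM_below (p q p' q' : {poly F}) n :
  (forall k, (k <= n)%N -> p`_k = p'`_k) ->
  (forall k, (k <= n)%N -> q`_k = q'`_k) -> (p * q)`_n = (p' * q')`_n.
Proof.
move=> pp' qq'; rewrite !coefM; apply: eq_bigr => j _.
by rewrite pp' ?qq' ?leq_subr // -ltnS.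
Qed.

Lemma lmulC : commutative lmul.
Proof.
move=> x y; have [[N x0] [M y0]] := (laurent_bounded x, laurent_bounded y).
apply: (@laurent_eq_below _ _ (N + M)).
- exact: vanish_lconv.
- by rewrite addrC; apply: vanish_lconv.
- move=> k /=; rewrite (lconv_trunc x0 y0 (leqnn k)) mulrC.
  by rewrite (addrC N) (lconv_trunc y0 x0 (leqnn k)).
Qed.

Lemma lmulA : associative lmul.
Proof.
move=> x y z; have [N x0] := laurent_bounded x.
have [[M y0] [L z0]] := (laurent_bounded y, laurent_bounded z).
have [xy0 yz0] := (vanish_lconv x0 y0, vanish_lconv y0 z0).
apply: (@laurent_eq_below _ _ (N + M + L)).
- by rewrite -addrA; apply: vanish_lconv.
- exact: vanish_lconv.
- move=> k /=; rewrite (lconv_trunc xy0 z0 (leqnn k)).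
  rewrite -(addrA N) (lconv_trunc x0 yz0 (leqnn k)).
  transitivity (trunc x N k * (trunc y M k * trunc z L k))`_k.
    apply: coefM_below => // j jk.
    by rewrite coef_trunc // (lconv_trunc y0 z0 jk).
  rewrite mulrA; apply: coefM_below => // j jk.
  by rewrite coef_trunc // (lconv_trunc x0 y0 jk).
Qed.

Lemma lmul1 : left_id lone lmul.
Proof.
move=> x; apply: laurentP => n /=; rewrite /lconv.
rewrite (@fsum_int_ord _ (fun k : nat => k%:Z) 1).
- by rewrite big_ord1 mul1r subr0.
- by move=> i j [].
- by move=> i /(_ 0%N isT); rewrite eq_sym => /negPf ->; rewrite mul0r.
Qed.

Lemma lmulDl : left_distributive lmul ladd.
Proof.
move=> x y z; have [N [x0 y0]] := laurent_bounded2 x y.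
have [M z0] := laurent_bounded z.
have xy0 : vanish_above (ladd x y) N by move=> i Ni /=; rewrite x0 ?y0 ?addr0.
apply: (@laurent_eq_below _ _ (N + M)).
- exact: vanish_lconv.
- move=> i Ni /=; rewrite !(@vanish_lconv _ _ N M) ?addr0 //.
- move=> k /=; rewrite (lconv_trunc xy0 z0 (leqnn k)).
  rewrite (lconv_trunc x0 z0 (leqnn k)) (lconv_trunc y0 z0 (leqnn k)).
  rewrite -coefD -mulrDl; apply: coefM_below => // j jk.
  by rewrite coefD !coef_trunc.
Qed.

Lemma lone_neq0 : lone != 0 :> laurent F.
Proof.
by apply/eqP => /(congr1 (@lcoef F))/(congr1 (@^~ 0))/eqP; rewrite oner_eq0.
Qed.

HB.instance Definition _ := GRing.Zmodule_isComNzRing.Build (laurent F)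
  lmulA lmulC lmul1 lmulDl lone_neq0.

Definition is_deg x (d : int) := x d != 0 /\ vanish_above x d.

(* 0 has no degree; ldeg 0 is the dummy value 0. *)
Definition ldeg x : int := xget 0 [set d | is_deg x d].

Lemma ldegP x : x != 0 -> is_deg x (ldeg x).
Proof.
move=> xN0; rewrite /ldeg; apply: (@xgetPex _ 0 [set d | is_deg x d]).
have [N x0] := laurent_bounded x.
have ex : exists k : nat, x (N - k%:Z) != 0.
  apply: contrapT => /forallNP xz; move/eqP: xN0; apply.
  by apply: (laurent_eq_below x0) => // k; apply/eqP/negPn/negP/xz.
exists (N - (ex_minn ex)%:Z); case: ex_minnP => k xk mink; split=> // i ki.
have [Ni|iN] := ltP N i; first by rewrite x0.
apply: contraTeq isT => xi; have := mink `|N - i|%N.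
have -> : N - `|N - i|%N%:Z = i by lia.
by move=> /(_ xi); lia.
Qed.

(* Coefficients of the inverse of the power series with coefficients a. *)
Fixpoint inv_seq (a : nat -> F) (n : nat) : seq F :=
  if n is m.+1 then
    let s := inv_seq a m in
    rcons s (- ((a 0%N)^-1 * \sum_(k < m.+1) a k.+1 * s`_(m - k)))
  else [:: (a 0%N)^-1].

Lemma size_inv_seq a n : size (inv_seq a n) = n.+1.
Proof. by elim: n => //= n IHn; rewrite size_rcons IHn. Qed.

Lemma nth_inv_seq a n k : (k <= n)%N -> (inv_seq a n)`_k = (inv_seq a k)`_k.
Proof.
elim: n => [|n IHn]; first by rewrite leqn0 => /eqP ->.
rewrite leq_eqVlt => /orP[/eqP -> //|kn] /=.
by rewrite nth_rcons size_inv_seq kn IHn.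
Qed.

Lemma inv_seqP a n : a 0%N != 0 ->
  \sum_(k < n.+1) a k * (inv_seq a (n - k))`_(n - k) = (n == 0%N)%:R.
Proof.
move=> a0; case: n => [|n]; first by rewrite big_ord1 /= mulfV.
rewrite big_ord_recl subn0 /= nth_rcons size_inv_seq ltnn eqxx.
rewrite mulrN mulVKf // addrC; apply/eqP; rewrite subr_eq0; apply/eqP.
apply: eq_bigr => i _ /=; rewrite /bump /= add1n subSS.
by rewrite [in RHS]nth_inv_seq ?leq_subr.
Qed.

Lemma linv_exists x : x != 0 -> exists y, y * x = 1.
Proof.
move=> /ldegP[]; set d := ldeg x => xd x0.
pose a (k : nat) := x (d - k%:Z).
pose g (i : int) := if i <= - d then (inv_seq a `|- d - i|)`_`|- d - i| else 0.
have g0 : vanish_above g (- d) by move=> i di; rewrite /g leNgt di.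
exists (Laurent (ex_intro _ _ g0)); rewrite mulrC.
apply: (@laurent_eq_below _ _ (d + - d)).
- exact: vanish_lconv.
- by rewrite subrr => i i0 /=; rewrite gt_eqF.
- move=> k /=; rewrite (lconv_trunc x0 g0 (leqnn k)) coefM.
  have a0 : a 0%N != 0 by rewrite /a subr0.
  have -> : (d - d - k%:Z == 0) = (k == 0%N) by lia.
  rewrite -(inv_seqP k a0); apply: eq_bigr => i _.
  rewrite !coef_trunc ?leq_subr -1?ltnS // /g.
  rewrite ifT; last by lia.
  by congr (_ * (inv_seq a _)`_ _); lia.
Qed.

Definition linv x : laurent F := xget 0 [set y | y * x = 1].

Lemma linvP x : x != 0 -> linv x * x = 1.
Proof.
by move=> /linv_exists xV; apply: (@xgetPex _ 0 [set y | y * x = 1]).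
Qed.

Lemma linv0 : linv 0 = 0.
Proof.
rewrite /linv; case: xgetP => // y _ /= /eqP.
by rewrite mulr0 eq_sym oner_eq0.
Qed.

HB.instance Definition _ := GRing.ComNzRing_isField.Build (laurent F) linvP linv0.

Lemma lpoly_subproof (p : {poly F}) :
  exists N, vanish_above (fun i => if 0 <= i then p`_`|i| else 0) N.
Proof.
exists (size p)%:Z => i pi; case: ifP => // i0.
by apply: nth_default; rewrite -lez_nat gez0_abs // ltW.
Qed.

Definition lpoly (p : {poly F}) : laurent F := Laurent (lpoly_subproof p).

Lemma lpoly_is_zmod_morphism : zmod_morphism lpoly.
Proof.
move=> p q; apply: laurentP => i /=.
by case: ifP; rewrite ?coefB ?subr0.
Qed.

Lemma lpoly_is_monoid_morphism : monoid_morphism lpoly.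
Proof.
split.
  apply: laurentP => i /=; rewrite coef1 absz_eq0.
  by case: eqP => [->//|_]; case: ifP.
move=> p q; apply: laurentP => n /=; rewrite /lconv.
case: ifPn => n0; last first.
  rewrite fsbig1 // => i _ /=; case: ifP => i0; rewrite ?mul0r //.
  by rewrite ifF ?mulr0 //; lia.
rewrite (@fsum_int_ord _ (fun k : nat => k%:Z) `|n|.+1) ?coefM.
- apply: eq_bigr => j _ /=; rewrite ifT; last by have := ltn_ord j; lia.
  by congr (_ * q`_ _); have := ltn_ord j; lia.
- by move=> i j [].
- move=> i iNh; case: ifP => i0; rewrite ?mul0r // ifF ?mulr0 //.
  apply/negP => ni; have /negP := iNh `|i|%N ltac:(lia); apply; lia.
Qed.

HB.instance Definition _ := GRing.isZmodMorphism.Build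
  {poly F} (laurent F) lpoly lpoly_is_zmod_morphism.
HB.instance Definition _ := GRing.isMonoidMorphism.Build
  {poly F} (laurent F) lpoly lpoly_is_monoid_morphism.

Lemma lfrac_subproof x :
  exists N, vanish_above (fun i => if i < 0 then x i else 0) N.
Proof. by exists 0 => i i0; rewrite ltNge ltW. Qed.

Definition lfrac x : laurent F := Laurent (lfrac_subproof x).

Definition lirrational x :=
  ~ exists P Q : {poly F}, Q != 0 /\ x = lpoly P / lpoly Q.

End LaurentField.

Definition lnorm (R : realType) (F : finFieldType) (x : laurent F) : R :=
  if x == 0 then 0 else #|F|%:R ^ ldeg x.

Section ContinuedFraction.
Variable F : fieldType.
Implicit Type A : nat -> {poly F}.

Fixpoint cfrac A (n : nat) : laurent F :=
  if n is m.+1 then lpoly (A 0%N) + (cfrac (fun i => A i.+1) m)^-1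
  else lpoly (A 0%N).

(* The sequence u with u_(-1) = a, u_0 = b, u_(k+1) = A_(k+1) u_k + u_(k-1):
   cf_rec A a b k = (u_(k-1), u_k). *)
Fixpoint cf_rec A (a b : {poly F}) (k : nat) : {poly F} * {poly F} :=
  if k is m.+1 then
    let: (u', u) := cf_rec A a b m in (u, A m.+1 * u + u')
  else (a, b).

Definition cf_num A k : {poly F} := (cf_rec A 1 (A 0%N) k).2.
Definition cf_den A k : {poly F} := (cf_rec A 0 1 k).2.

Lemma cf_numS A k :
  cf_num A k.+2 = A k.+2 * cf_num A k.+1 + cf_num A k.
Proof. by rewrite /cf_num /=; case: cf_rec. Qed.

Lemma cf_denS A k :
  cf_den A k.+2 = A k.+2 * cf_den A k.+1 + cf_den A k.
Proof. by rewrite /cf_den /=; case: cf_rec. Qed.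

Lemma cf_den_shift A k : cf_den A k.+1 = cf_num (fun i => A i.+1) k.
Proof.
suff [] : cf_den A k.+1 = cf_num (fun i => A i.+1) k /\
  cf_den A k.+2 = cf_num (fun i => A i.+1) k.+1 by [].
elim: k => [|k [IH1 IH2]]; last first.
  by split=> //; rewrite cf_denS cf_numS IH1 IH2.
by rewrite /cf_den /cf_num /= mulr1 addr0.
Qed.

Lemma cf_num_shift A k : cf_num A k.+1 =
  A 0%N * cf_num (fun i => A i.+1) k + cf_den (fun i => A i.+1) k.
Proof.
pose B i := A i.+1.
suff [] : cf_num A k.+1 = A 0%N * cf_num B k + cf_den B k /\
  cf_num A k.+2 = A 0%N * cf_num B k.+1 + cf_den B k.+1 by [].
elim: k => [|k [IH1 IH2]]; last first.
  by split=> //; rewrite cf_numS IH1 IH2 [cf_num B k.+2]cf_numS cf_denS /B; ring.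
by rewrite /cf_den /cf_num /B /=; split; ring.
Qed.

Lemma size_cf_den A k : (forall i, (0 < i)%N -> (1 < size (A i))%N) ->
  (size (cf_den A k) < size (cf_den A k.+1))%N.
Proof.
move=> A1; elim: k => [|k IHk].
  by rewrite /cf_den /= mulr1 addr0 size_poly1 A1.
have dN0 : cf_den A k.+1 != 0 by rewrite -size_poly_gt0 (leq_ltn_trans _ IHk).
have AN0 : A k.+2 != 0 by rewrite -size_poly_gt0 ltnW ?A1.
have lt_mul : (size (cf_den A k.+1) < size (A k.+2 * cf_den A k.+1)%R)%N.
  rewrite size_mul //; case: (size (A k.+2)) (A1 k.+2 isT) => [|[|a]] // _.
  by rewrite !addSn /= ltnS leq_addl.
by rewrite cf_denS size_polyDl // (ltn_trans IHk).
Qed.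

Lemma cf_den_neq0 A k : (forall i, (0 < i)%N -> (1 < size (A i))%N) ->
  cf_den A k != 0.
Proof.
move=> A1; rewrite -size_poly_gt0; case: k => [|k].
  by rewrite /cf_den /= size_poly1.
by rewrite (leq_ltn_trans _ (size_cf_den k A1)).
Qed.

Lemma lpoly_eq0 (p : {poly F}) : (lpoly p == 0) = (p == 0).
Proof.
apply/eqP/eqP => [p0|->]; last exact: rmorph0.
by apply/polyP => i; have := congr1 (fun x : laurent F => x i%:Z) p0; rewrite coef0.
Qed.

Lemma cfracE A n : (forall i, (0 < i)%N -> (1 < size (A i))%N) ->
  cfrac A n = lpoly (cf_num A n) / lpoly (cf_den A n).
Proof.
elim: n A => [|n IHn] A A1 /=; first by rewrite /cf_den /= rmorph1 divr1.
rewrite IHn; last by move=> i _; apply: A1.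
have := cf_den_neq0 n.+1 A1; rewrite -lpoly_eq0 cf_den_shift => nN0.
by rewrite invf_div cf_num_shift rmorphD rmorphM mulrDl mulfK.
Qed.

End ContinuedFraction.

(* The infinite continued fraction A_0 + 1/(A_1 + 1/(A_2 + ...)) is read as
   the limit of its finite truncations. *)
Definition cf_expansion (R : realType) (F : finFieldType) (alpha : laurent F)
    (A : nat -> {poly F}) :=
  (forall i, (0 < i)%N -> (1 < size (A i))%N) /\
  (lnorm R (alpha - cfrac A n) @[n --> \oo] --> (0 : R)).

Section SingularOnAverage.
Variables (R : realType) (F : finFieldType).
Implicit Types (alpha : laurent F) (c : R).

Definition solvable_at alpha c (l : nat) :=
  exists Q : {poly F},
    [/\ 0 < lnorm R (lpoly Q), lnorm R (lpoly Q) <= 2 ^+ l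
      & lnorm R (lfrac (lpoly Q * alpha)) <= c * 2 ^- l].

Definition Delta alpha c (N : nat) : nat :=
  \sum_(1 <= l < N.+1) `[< solvable_at alpha c l >].

Definition singular_on_average alpha :=
  forall c, 0 < c -> (Delta alpha c N)%:R / N%:R @[N --> \oo] --> (1 : R).

End SingularOnAverage.

(* Main.v *)
(* Let d_k = deg Q_k.  The convergent Q_k realises |{Q_k alpha}| <= q^(-d_(k+1)),
   and no nonzero Q of degree < d_(k+1) does better: otherwise Q P_(k+1) = P Q_(k+1)
   for the polynomial part P of Q alpha, and Q_(k+1) is coprime to P_(k+1).  Hence if
   q^d_k <= 2^l < q^d_(k+1), failure at l for c >= 2^(-m) forces
   q^d_(k+1) < 2^(l+m), which leaves at most m values of l for each k; conversely,
   for c = 1/4, the largest l with 2^l < q^d_k fails for every k >= 2.  So the number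
   of failures up to N is comparable to the number of k with d_k = O(N), and it is
   o(N) exactly when d_k / k tends to infinity. *)
Require Import Defs.
From mathcomp Require Import all_boot all_order all_algebra.
From mathcomp Require Import all_classical all_reals all_analysis.
From mathcomp Require Import zify ring.

Set Implicit Arguments.
Unset Strict Implicit.
Unset Printing Implicit Defensive.

Import Order.TTheory GRing.Theory Num.Theory.
Import numFieldNormedType.Exports.
Local Open Scope classical_set_scope.
Local Open Scope ring_scope.

Local Notation deg_le x := (vanish_above (lcoef x)).

(** * Degree bounds for Laurent series *)

Section Degree.
Variable F : fieldType.
Implicit Types (x y : laurent F) (P Q : {poly F}) (N M : int).

Lemma vanish_aboveD x y N :
  deg_le x N -> deg_le y N -> deg_le (x + y) N.
Proof. by move=> x0 y0 i Ni /=; rewrite x0 ?y0 ?addr0. Qed.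

Lemma vanish_aboveB x y N :
  deg_le x N -> deg_le y N -> deg_le (x - y) N.
Proof. by move=> x0 y0 i Ni /=; rewrite x0 ?y0 ?subr0. Qed.

Lemma vanish_aboveM x y N M :
  deg_le x N -> deg_le y M -> deg_le (x * y) (N + M).
Proof. exact: vanish_lconv. Qed.

Lemma lmul_coef_top x y N M : deg_le x N -> deg_le y M ->
  (x * y) (N + M) = x N * y M.
Proof.
move=> x0 y0; have := @lconv_trunc _ _ _ N M 0 0 x0 y0 (leqnn _).
by rewrite subr0 coefM big_ord1 !coef_trunc // !subr0.
Qed.

(** Leading coefficients multiply, so an inverse of larger degree would give the product, which is
    1, a nonzero coefficient at a positive index. *)
Lemma vanish_above_inv x N : is_deg x N -> deg_le x^-1 (- N).
Proof.
move=> [xN x0].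
have xn0 : x != 0 by apply: contraNneq xN => ->.
have yn0 : x^-1 != 0 by rewrite invr_eq0.
have [yM y0] := ldegP yn0; apply: (vanish_aboveW _ y0).
rewrite leNgt; apply/negP => NM; have := lmul_coef_top x0 y0.
have /negPf NM0 : N + ldeg x^-1 != 0 by rewrite gt_eqF // -ltrBlDl sub0r.
rewrite mulfV //= NM0.
by move=> /esym/eqP; rewrite mulf_eq0 (negPf xN) (negPf yM).
Qed.

Lemma is_deg_lpoly Q : Q != 0 -> is_deg (lpoly Q) (size Q).-1%:Z.
Proof.
move=> Q0; split=> [|i si] /=; first by rewrite -[_`_ _]/(lead_coef Q) lead_coef_eq0.
case: ifP => // i0; rewrite nth_default //.
by case: (size _) (size_poly_gt0 Q) si => [|n]; rewrite Q0 //; lia.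
Qed.

Lemma lpoly_vanish_eq0 Q : deg_le (lpoly Q) (-1) -> Q = 0.
Proof.
move=> Q0; apply/polyP => i; rewrite coef0.
by have := Q0 i%:Z isT.
Qed.

Lemma lfrac_subr x : exists P, lfrac x = x - lpoly P.
Proof.
have [N x0] := laurent_bounded x.
exists (\poly_(i < `|N|.+1) x i%:Z); apply: laurentP => i /=.
have [i0|i0] := ltP i 0; first by rewrite subr0.
rewrite coef_poly gez0_abs //; case: ifP => Ni; first by rewrite subrr.
by rewrite subr0 x0 //; lia.
Qed.

(** Polynomials have no coefficients at negative indices, so any [P] will do, not only the
    polynomial part of [x]. *)
Lemma vanish_lfrac x P N :
  deg_le (x - lpoly P) N -> deg_le (lfrac x) N.
Proof.
move=> xP0 i Ni /=; case: ifP => // i0.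
by have := xP0 i Ni; rewrite /= leNgt i0 /= subr0.
Qed.

End Degree.

(** * Passing between norms and degrees *)

Section Norm.
Variables (R : realType) (F : finFieldType).
Implicit Types (x : laurent F) (Q : {poly F}) (N : int).

Lemma card_gt1R : 1 < #|F|%:R :> R.
Proof. by rewrite ltr1n card_finNzRing_gt1. Qed.

Lemma card_gt0R : 0 < #|F|%:R :> R.
Proof. exact: lt_trans card_gt1R. Qed.

Lemma lnorm_le_vanish x N : deg_le x N -> lnorm R x <= #|F|%:R ^ N.
Proof.
move=> x0; rewrite /lnorm; case: eqVneq => [_|xn0].
  by rewrite exprz_ge0 // ltW ?card_gt0R.
rewrite ler_eXz2l ?card_gt1R // leNgt; apply/negP => Nx.
by have [/eqP xd _] := ldegP xn0; apply/xd/x0.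
Qed.

Lemma lnorm_lt_vanish x N : lnorm R x < #|F|%:R ^ N -> deg_le x (N - 1).
Proof.
rewrite /lnorm; case: eqVneq => [-> //|xn0].
rewrite ltr_eXz2l ?card_gt1R // => xN.
by have [_] := ldegP xn0; apply: vanish_aboveW; lia.
Qed.

Lemma lnorm_lpoly Q : Q != 0 -> lnorm R (lpoly Q) = #|F|%:R ^+ (size Q).-1.
Proof.
move=> Q0; rewrite /lnorm lpoly_eq0 (negPf Q0).
have [Qd d0] := @ldegP _ (lpoly Q) ltac:(by rewrite lpoly_eq0).
have [Qe e0] := is_deg_lpoly Q0.
have -> // : ldeg (lpoly Q) = (size Q).-1%:Z.
apply/eqP; rewrite eq_le; apply/andP; split; rewrite leNgt; apply/negP.
  by move=> /e0/eqP; rewrite (negPf Qd).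
by move=> /d0/eqP; rewrite (negPf Qe).
Qed.

End Norm.

(** * Denominator degrees and differences of convergents *)

Definition cf_deg (F : fieldType) (A : nat -> {poly F}) k := (size (cf_den A k)).-1.

Section Convergents.
Variables (F : fieldType) (A : nat -> {poly F}).
Hypothesis A1 : forall i, (0 < i)%N -> (1 < size (A i))%N.
Local Notation d := (cf_deg A).
Local Notation P := (cf_num A).
Local Notation Q := (cf_den A).

Lemma cf_deg0 : d 0 = 0%N.
Proof. by rewrite /cf_deg /cf_den /= size_poly1. Qed.

Lemma ltn_cf_degS k : (d k < d k.+1)%N.
Proof.
rewrite /cf_deg; have := size_cf_den k A1.
by have := cf_den_neq0 k A1; rewrite -size_poly_gt0; lia.
Qed.

Lemma leq_cf_deg j k : (j <= k)%N -> (d j <= d k)%N.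
Proof.
by move: j k; apply: (homo_leq leqnn leq_trans) => k; apply/ltnW/ltn_cf_degS.
Qed.

Lemma leq_id_cf_deg k : (k <= d k)%N.
Proof. by elim: k => // k IHk; apply: leq_ltn_trans (ltn_cf_degS k). Qed.

Lemma is_deg_cf_den k : is_deg (lpoly (Q k)) (d k)%:Z.
Proof. exact/is_deg_lpoly/cf_den_neq0. Qed.

Lemma cf_det k : P k.+1 * Q k - P k * Q k.+1 = (-1) ^+ k.
Proof.
elim: k => [|k IHk]; first by rewrite /cf_num /cf_den /= expr0; ring.
by rewrite cf_numS cf_denS exprS -IHk; ring.
Qed.

Lemma cf_coprime k : coprimep (Q k.+1) (P k.+1).
Proof.
apply/Bezout_eq1_coprimepP; exists ((- (-1) ^+ k * P k), ((-1) ^+ k * Q k)) => /=.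
transitivity ((-1) ^+ k * (P k.+1 * Q k - P k * Q k.+1)); first by ring.
by rewrite cf_det -expr2 sqrr_sign.
Qed.

(** By the determinant identity the difference is [(-1) ^+ k] divided by the product of the two
    denominators. *)
Lemma cfrac_step k :
  deg_le (cfrac A k.+1 - cfrac A k) (- ((d k)%:Z + (d k.+1)%:Z)).
Proof.
have QN0 j : lpoly (Q j) != 0 by rewrite lpoly_eq0 cf_den_neq0.
have -> : cfrac A k.+1 - cfrac A k =
    lpoly ((-1) ^+ k) * ((lpoly (Q k))^-1 * (lpoly (Q k.+1))^-1).
  rewrite !cfracE // -cf_det rmorphB !rmorphM.
  by field; rewrite !QN0.
rewrite -[- (_ + _)]add0r opprD; apply: vanish_aboveM.
  rewrite -signr_odd.
  by case: odd; rewrite ?expr1 ?rmorphN rmorph1 => i i0 /=; rewrite gt_eqF ?oppr0.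
by apply: vanish_aboveM; apply: vanish_above_inv; apply: is_deg_cf_den.
Qed.

(** Telescoping and the ultrametric inequality: the first step dominates because [d] increases. *)
Lemma cfrac_cauchy k n : (k <= n)%N ->
  deg_le (cfrac A n - cfrac A k) (- ((d k)%:Z + (d k.+1)%:Z)).
Proof.
elim: n => [|n IHn]; first by rewrite leqn0 => /eqP ->; rewrite subrr.
rewrite leq_eqVlt => /orP[/eqP <-|kn]; first by rewrite subrr.
rewrite -(subrKA (cfrac A n)); apply: vanish_aboveD (IHn kn).
apply: (vanish_aboveW _ (@cfrac_step n)).
have := leq_cf_deg (kn : k <= n)%N; have := leq_cf_deg (kn : k.+1 <= n.+1)%N; lia.
Qed.

End Convergents.

(** * Both limits as inequalities between natural numbers *)

Section Asymptotics.
Variable R : realType.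

(** Density one means that the failures of [u] are o(N); [E] stands for the inverse of the
    tolerance. *)
Lemma density_one (u : pred nat) :
  ((\sum_(1 <= l < N.+1) u l)%N%:R / N%:R @[N --> \oo] --> (1 : R)) <->
  (forall E, \forall N \near \oo, (E * \sum_(1 <= l < N.+1) ~~ u l <= N)%N).
Proof.
have uN N : (\sum_(1 <= l < N.+1) u l + \sum_(1 <= l < N.+1) ~~ u l = N)%N.
  rewrite -big_split /= (eq_bigr (fun=> 1%N)).
    by rewrite sum_nat_const_nat muln1 subn1.
  by move=> l _; case: (u l).
have dist N : (0 < N)%N ->
    1 - (\sum_(1 <= l < N.+1) u l)%N%:R / N%:R =
    (\sum_(1 <= l < N.+1) ~~ u l)%N%:R / N%:R :> R.
  move=> N0; have NR0 : N%:R != 0 :> R by rewrite pnatr_eq0 -lt0n.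
  apply: (mulIf NR0); rewrite mulrBl !divfK // mul1r.
  by rewrite -[X in X%:R - _](uN N) natrD addrAC subrr add0r.
split=> [/cvgrPdist_lt lim E|lim].
  (* The successor keeps the tolerance positive at [E = 0]. *)
  have E0 : 0 < E.+1%:R^-1 :> R by rewrite invr_gt0 ltr0n.
  near=> N; have N0 : (0 < N)%N by near: N; exists 1%N.
  have : `|1 - (\sum_(1 <= l < N.+1) u l)%N%:R / N%:R| < E.+1%:R^-1 :> R.
    by near: N; exact: lim.
  rewrite dist // ger0_norm ?divr_ge0 // ltr_pdivrMr ?ltr0n //.
  rewrite mulrC ltr_pdivlMr ?ltr0n // -natrM ltr_nat mulnC => /ltnW.
  by apply: leq_trans; rewrite leq_mul2r leqnSn orbT.
apply/cvgrPdist_lt => e e0; near=> N.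
have N0 : (0 < N)%N by near: N; exists 1%N.
rewrite dist // ger0_norm ?divr_ge0 // ltr_pdivrMr ?ltr0n //.
set E := (Num.truncn e^-1).+1.
have Ee : e^-1 < E%:R by apply: truncnS_gt.
have : (E * \sum_(1 <= l < N.+1) ~~ u l <= N)%N by near: N; exact: lim.
rewrite -(ler_nat R) natrM => EN.
have E0 : 0 < E%:R :> R by rewrite ltr0n.
apply: (@le_lt_trans _ _ (N%:R / E%:R)); first by rewrite ler_pdivlMr // mulrC.
by rewrite mulrC ltr_pM2r ?ltr0n // invf_plt ?posrE.
Unshelve. all: by end_near. Qed.

(** Testing divergence against the powers [q ^ M] suffices, and raising to the [k]-th power turns
    each test into a comparison of exponents. *)
Lemma root_exp_cvgy (q : nat) (d : nat -> nat) : (1 < q)%N ->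
  ((q%:R ^+ d k : R) `^ k%:R^-1 @[k --> \oo] --> +oo) <->
  (forall M, \forall k \near \oo, (M * k <= d k)%N).
Proof.
move=> q1; have q0 : 0 < q%:R :> R by rewrite ltr0n ltnW.
have rootE k M : (0 < k)%N ->
    (q%:R ^+ M <= (q%:R ^+ d k : R) `^ k%:R^-1) = (M * k <= d k)%N.
  move=> k0; rewrite -(@ler_pXn2r _ k) ?nnegrE ?powR_ge0 ?exprn_ge0 ?ler0n //.
  rewrite -exprM -(powR_mulrn _ (powR_ge0 _ _)) -powRrM mulVf ?pnatr_eq0 -?lt0n //.
  by rewrite powRr1 ?exprn_ge0 ?ler0n // ler_eXn2l ?ltr1n.
split=> [/cvgryPge lim M|lim].
  near=> k; have k0 : (0 < k)%N by near: k; exists 1%N.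
  by rewrite -rootE //; near: k; exact: lim.
apply/cvgryPge => B; near=> k.
have k0 : (0 < k)%N by near: k; exists 1%N.
apply: (@le_trans _ _ (q%:R ^+ (Num.truncn B).+1)).
  apply/ltW/(lt_trans (truncnS_gt B)); rewrite -natrX ltr_nat.
  exact: ltn_expl.
by rewrite rootE //; near: k; exact: lim.
Unshelve. all: by end_near. Qed.

End Asymptotics.

(** * Counting in windows and along increasing sequences *)

Lemma sum_window_le (t m N : nat) :
  (\sum_(1 <= l < N.+1) ((t < l + m) && (l <= t)) <= m)%N.
Proof.
have le1 : (\sum_(1 <= l < N.+1) ((t < l + m) && (l <= t)) <=
    \sum_(0 <= l < N.+1) ((t < l + m) && (l <= t)))%N.
  by rewrite (big_ltn (ltn0Sn N)) leq_addl.
apply: leq_trans le1 _.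
(* The window starts at [t.+1 - m], where truncated subtraction gives 0 if [m] exceeds [t.+1]. *)
have : forall n, (\sum_(0 <= l < n) ((t < l + m) && (l <= t)) =
    minn n t.+1 - (t.+1 - m))%N.
  elim=> [|n IHn]; first by rewrite big_geq // min0n.
  by rewrite big_nat_recr //= IHn; lia.
by move=> ->; lia.
Qed.

(** Induction on [n]: the sum is cut at the last point [l n.+1], and the earlier points lie below
    the cut. The sum starts at 1, hence the condition on [l 0]. *)
Lemma sum_increasing_ge (v : pred nat) (l : nat -> nat) (n N : nat) :
  (forall i, (l i < l i.+1)%N) -> (forall i, v (l i)) -> (0 < l 0)%N ->
  (l n <= N)%N -> (n < \sum_(1 <= i < N.+1) v i)%N.
Proof.
move=> l_lt vl l0; elim: n N => [|n IHn] N lN.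
  rewrite (big_cat_nat (n := l 0)) //=; last exact: leqW.
  by rewrite (@big_ltn _ _ _ (l 0)) ?ltnS // vl addnCA.
rewrite (big_cat_nat (n := l n.+1)) //=; [|by have := l_lt n; lia|exact: leqW].
rewrite (@big_ltn _ _ _ (l n.+1)) ?ltnS // vl addnCA add1n ltnS.
case E: (l n.+1) (l_lt n) => [//|j] lj.
by apply: leq_trans (IHn j lj) (leq_addr _ _).
Qed.

(** * Approximation by convergents and the count of failures *)

Section Approximation.
Variables (R : realType) (F : finFieldType) (alpha : laurent F).
Variable A : nat -> {poly F}.
Hypothesis alphaA : cf_expansion R alpha A.
Local Notation d := (cf_deg A).
Local Notation q := #|F|.

Let A1 : forall i, (0 < i)%N -> (1 < size (A i))%N := alphaA.1.

(** A late convergent approximates [alpha] to degree [D], and the [k]-th one differs from it by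
    degree at most [D]; multiplying by the denominator adds [d k]. *)
Lemma cf_den_approx k :
  deg_le (lpoly (cf_den A k) * alpha - lpoly (cf_num A k)) (- (d k.+1)%:Z).
Proof.
set D : int := - ((d k)%:Z + (d k.+1)%:Z).
have [n [kn n0]] : exists n, (k <= n)%N /\ deg_le (alpha - cfrac A n) D.
  (* A norm strictly below [q ^ (D + 1)] forces degree at most [D]. *)
  have /cvgrPdist_lt /(_ (q%:R ^ (D + 1))) := alphaA.2.
  rewrite exprz_gt0 ?card_gt0R // => /(_ isT) [n _ /(_ (maxn k n))].
  rewrite /= leq_maxr sub0r normrN => /(_ isT) h; exists (maxn k n).
  split; first exact: leq_maxl.
  by have := lnorm_lt_vanish (le_lt_trans (ler_norm _) h); rewrite addrK.
have -> : - (d k.+1)%:Z = (d k)%:Z + D by rewrite /D; lia.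
have -> : lpoly (cf_den A k) * alpha - lpoly (cf_num A k) =
    lpoly (cf_den A k) * (alpha - cfrac A k).
  rewrite mulrBr cfracE // mulrC [in RHS]mulrCA mulfV ?mulr1 1?mulrC //.
  by rewrite lpoly_eq0 cf_den_neq0.
apply: vanish_aboveM; first by case: (is_deg_cf_den A1 k).
by rewrite -(subrKA (cfrac A n)); apply: vanish_aboveD (cfrac_cauchy A1 kn).
Qed.

Lemma cf_best_approx k (Q : {poly F}) : Q != 0 -> ((size Q).-1 < d k.+1)%N ->
  ~ deg_le (lfrac (lpoly Q * alpha)) (- (d k.+1)%:Z - 1).
Proof.
move=> Q0 Qk; have [P ->] := lfrac_subr (lpoly Q * alpha) => QP.
have QP0 : Q * cf_num A k.+1 = P * cf_den A k.+1.
  apply/eqP; rewrite -subr_eq0; apply/eqP/lpoly_vanish_eq0.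
  (* This combination cancels [alpha]. Its terms have degree at most [-1] and
     [(size Q).-1 - d k.+2], both negative, so the polynomial vanishes. *)
  have -> : lpoly (Q * cf_num A k.+1 - P * cf_den A k.+1) =
    lpoly (cf_den A k.+1) * (lpoly Q * alpha - lpoly P) -
    lpoly Q * (lpoly (cf_den A k.+1) * alpha - lpoly (cf_num A k.+1)).
    by rewrite rmorphB !rmorphM; ring.
  apply: vanish_aboveB.
    apply: (@vanish_aboveW _ _ ((d k.+1)%:Z + (- (d k.+1)%:Z - 1))); first by lia.
    exact: vanish_aboveM (is_deg_cf_den A1 k.+1).2 QP.
  apply: (@vanish_aboveW _ _ ((size Q).-1%:Z + (- (d k.+2)%:Z))).
    by have := ltn_cf_degS A1 k.+1; lia.
  exact: vanish_aboveM (is_deg_lpoly Q0).2 (@cf_den_approx k.+1).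
have : cf_den A k.+1 %| Q.
  by rewrite -(Gauss_dvdpl _ (cf_coprime A k)) QP0 dvdp_mulIr.
by move=> /(dvdp_leq Q0) /(leq_sub2r 1); rewrite !subn1 leqNgt Qk.
Qed.

(** For the greatest [k] with [q ^ d k <= 2 ^ l], the denominator [cf_den A k] would be a solution
    if [q ^ d k.+1] reached [2 ^ (l + m)]. *)
Lemma solvable_near (c : R) m l : 2 ^- m <= c -> ~ solvable_at alpha c l ->
  exists k, [/\ (q ^ d k <= 2 ^ l)%N, (2 ^ l < q ^ d k.+1)%N
              & (q ^ d k.+1 < 2 ^ (l + m))%N].
Proof.
move=> mc nsol; have q1 : (1 < q)%N by apply: card_finNzRing_gt1.
have ex0 : exists k, (q ^ d k <= 2 ^ l)%N by exists 0%N; rewrite cf_deg0 expn_gt0.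
have bd k : (q ^ d k <= 2 ^ l)%N -> (k <= l)%N.
  case: k => // k qk; rewrite -(@leq_exp2l 2) //; apply: leq_trans qk.
  have k1 := leq_id_cf_deg A1 k.+1.
  by apply: (@leq_trans (2 ^ d k.+1)); rewrite ?leq_exp2l ?leq_exp2r // (leq_trans _ k1).
have [k kl kmax] := ex_maxnP ex0 bd.
have lk : (2 ^ l < q ^ d k.+1)%N by rewrite ltnNge; apply/negP => /kmax; rewrite ltnn.
exists k; split => //; rewrite ltnNge; apply/negP => lmk; apply: nsol.
exists (cf_den A k); rewrite lnorm_lpoly ?cf_den_neq0 //; split.
- by rewrite exprn_gt0 ?card_gt0R.
- by rewrite -!natrX ler_nat.
- apply: (le_trans (lnorm_le_vanish R (vanish_lfrac (@cf_den_approx k)))).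
  apply: (@le_trans _ _ (2 ^- m * 2 ^- l)); last by rewrite ler_pM2r ?invr_gt0 ?exprn_gt0.
  rewrite -invfM -exprD -exprnN lef_pV2 ?posrE ?exprn_gt0 ?card_gt0R //.
  by rewrite addnC -!natrX ler_nat.
Qed.

(** With [c = 1/4] a solution has error at most [2 ^- (l + 2)], strictly below [q ^- d k.+1]; this
    strictness is what contradicts best approximation. *)
Lemma not_solvable_below k l : (2 ^ l < q ^ d k.+1)%N ->
  (q ^ d k.+1 <= 2 ^ l.+1)%N -> ~ solvable_at alpha (4^-1 : R) l.
Proof.
move=> lk kl [Q [Q0 Ql Qa]]; have q1 : (1 < q)%N by apply: card_finNzRing_gt1.
have {}Q0 : Q != 0 by apply: contraTneq Q0 => ->; rewrite rmorph0 /lnorm eqxx ltxx.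
apply: (@cf_best_approx k Q) => //.
  move: Ql; rewrite lnorm_lpoly // -!natrX ler_nat => /leq_ltn_trans/(_ lk).
  by rewrite ltn_exp2l.
apply: (@lnorm_lt_vanish R); apply: (le_lt_trans Qa).
rewrite -invfM -exprnN ltf_pV2 ?posrE ?mulr_gt0 ?exprn_gt0 ?card_gt0R //.
by rewrite -!natrX -natrM ltr_nat (leq_ltn_trans kl) // expnS ltn_pmul2r ?expn_gt0.
Qed.

Lemma unsolvable_count_ge k N : (1 < k)%N -> (q * d k <= N)%N ->
  (k.-1 <= \sum_(1 <= l < N.+1) ~~ `[< solvable_at alpha (4^-1 : R) l >])%N.
Proof.
have q1 : (1 < q)%N by apply: card_finNzRing_gt1.
(* For positive [i], the largest exponent with [2 ^ L i < q ^ d i]. *)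
pose L i := (up_log 2 (q ^ d i)).-1.
have dS i : (i < d i.+1)%N by apply: leq_id_cf_deg.
have LP i : (0 < i)%N -> (2 ^ L i < q ^ d i)%N && (q ^ d i <= 2 ^ (L i).+1)%N.
  case: i => // i _; have di := leq_ltn_trans (leq0n _) (dS i).
  have qd1 : (1 < q ^ d i.+1)%N by rewrite -(exp1n (d i.+1)) ltn_exp2r.
  have := up_log_bounds (isT : 1 < 2)%N qd1.
  by rewrite /L prednK // up_log_gt0.
have L_lt i : (0 < i)%N -> (L i < L i.+1)%N.
  move=> i0; rewrite -ltnS -(@ltn_exp2l 2) //.
  have /andP[_] := LP i.+1 isT; apply: leq_trans.
  have /andP[Lq _] := LP i i0.
  apply: (@leq_trans (q ^ (d i).+1)); last by rewrite leq_exp2l // ltn_cf_degS.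
  apply: (@leq_ltn_trans (q * 2 ^ L i)); first by rewrite expnS leq_mul2r q1 orbT.
  by rewrite expnS ltn_pmul2l // ltnW.
have L2 : (0 < L 2)%N.
  rewrite -ltnS -(@leq_exp2l 2) //; have /andP[_] := LP 2 isT; apply: leq_trans.
  by apply: (@leq_trans (q ^ 2)); [rewrite leq_exp2r|rewrite leq_exp2l // dS].
case: k => [|[|k]] // _ kN.
(* The points start at [L 2], since [L 1] is 0 when [q = 2] and [d 1 = 1]; this leaves [k.-1] points
   for the original [k]. *)
apply: (@sum_increasing_ge _ (fun i => L i.+2)) => // [i|i|].
- exact: L_lt.
- apply/negP => /asboolP; have /andP[] := LP i.+2 isT.
  exact: not_solvable_below.
- apply: leq_trans kN; rewrite -(@leq_exp2l 2) //.
  have /andP[/ltnW Lq _] := LP k.+2 isT; apply: leq_trans Lq _.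
  by rewrite expnM leq_exp2r ?(leq_trans _ (dS _)) // ltnW // ltn_expl.
Qed.

(** Every failure lies in a window of length [m] attached to some [k < K]; exchanging the sums
    bounds the total window by window. *)
Lemma unsolvable_count_le (c : R) m K N : 2 ^- m <= c ->
  (forall k, (d k <= N)%N -> (k < K)%N) ->
  (\sum_(1 <= l < N.+1) ~~ `[< solvable_at alpha c l >] <= K * m)%N.
Proof.
move=> mc dK; have q1 : (1 < q)%N by apply: card_finNzRing_gt1.
pose t k := trunc_log 2 (q ^ d k.+1).
pose window k l := (t k < l + m)%N && (l <= t k)%N.
apply: (@leq_trans (\sum_(1 <= l < N.+1) \sum_(k < K) window k l)); last first.
  rewrite exchange_big /= -[X in (_ <= X * _)%N]card_ord -sum_nat_const.
  by apply: leq_sum => k _; apply: sum_window_le.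
rewrite big_nat [leqRHS]big_nat; apply: leq_sum => l /andP[_ lN].
case: asboolP => //= /(solvable_near mc)[k [kl lk lmk]].
have dl : (d k <= l)%N.
  rewrite -(@leq_exp2l 2) //; apply: leq_trans kl.
  by case: (d k) => // e; rewrite leq_exp2r.
(* One index [k] whose window contains [l] already makes the inner sum at least 1. *)
rewrite (bigD1 (Ordinal (dK k (leq_trans dl lN)))) //= /window.
have /andP[tq qt] := trunc_log_bounds (isT : 1 < 2)%N (ltn_trans (expn_gt0 2 l) lk).
have -> : (t k < l + m)%N by rewrite -(@ltn_exp2l 2) // (leq_ltn_trans tq lmk).
have -> // : (l <= t k)%N by rewrite -ltnS -(@ltn_exp2l 2) // (ltn_trans lk qt).
Qed.

End Approximation.

Theorem theorem10p1 (R : realType) (F : finFieldType) (alpha : laurent F)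
    (A : nat -> {poly F}) (alpha_irrational : lirrational alpha)
    (alphaA : cf_expansion R alpha A) :
  singular_on_average R alpha <->
  (lnorm R (lpoly (cf_den A k)) `^ (k%:R^-1) @[k --> \oo] --> +oo).
Proof.
have A1 := alphaA.1; have q1 := card_finNzRing_gt1 F.
have -> : (fun k => lnorm R (lpoly (cf_den A k)) `^ (k%:R^-1)) =
    (fun k => (#|F|%:R ^+ cf_deg A k) `^ (k%:R^-1)).
  by apply/funext => k; rewrite lnorm_lpoly ?cf_den_neq0.
split=> [sing|/(root_exp_cvgy _ _ q1) lim c c0].
  apply/(root_exp_cvgy _ _ q1) => M.
  (* Used at [N = q * d_k], where there are at least [k.-1] failures: the factor [q] cancels, and
     the 2 absorbs the predecessor because [k <= 2 * k.-1] for [k >= 2]. *)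
  have /density_one/(_ (2 * #|F| * M)%N)[N0 _ lim] := sing 4^-1 ltac:(by []).
  near=> k.
  have k1 : (1 < k)%N by near: k; exists 2.
  have kN0 : (N0 <= k)%N by near: k; exists N0.
  have qd : (N0 <= #|F| * cf_deg A k)%N.
    apply: (leq_trans kN0); apply: (leq_trans (leq_id_cf_deg A1 k)).
    by rewrite leq_pmull // ltnW.
  have := unsolvable_count_ge alphaA k1 (leqnn _).
  move=> /(leq_mul (leqnn (2 * #|F| * M))) /leq_trans/(_ (lim _ qd)).
  have -> : (2 * #|F| * M * k.-1 = #|F| * (2 * M * k.-1))%N by ring.
  rewrite leq_pmul2l ?(ltnW q1) //; apply: leq_trans.
  by rewrite [X in (_ <= X)%N]mulnAC [X in (_ <= X)%N]mulnC leq_mul2l; lia.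
apply/density_one => E.
pose m := (Num.truncn c^-1).+1.
have mc : 2 ^- m <= c.
  rewrite -[c]invrK lef_pV2 ?posrE ?invr_gt0 ?exprn_gt0 //.
  apply/ltW/(lt_trans (truncnS_gt _)); rewrite -natrX ltr_nat.
  exact: ltn_expl.
(* Failures number at most [(k0.+1 + N %/ M) * m]. After multiplication by [E] each of the two terms
   is at most [N / 2], the first for large [N], the second by this choice of [M]; the successor
   makes [M] positive. *)
pose M := (2 * E * m).+1.
have [k0 _ dM] := lim M.
near=> N.
have N1 : (2 * E * m * k0.+1 <= N)%N by near: N; exists (2 * E * m * k0.+1)%N.
have dK k : (cf_deg A k <= N)%N -> (k < k0.+1 + N %/ M)%N.
  move=> dN; rewrite addSn ltnS; have [kk0|k0k] := leqP k k0.
    exact: leq_trans (leq_addr _ _).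
  apply: leq_trans (leq_addl _ _); rewrite leq_divRL // mulnC.
  exact: leq_trans (dM k (ltnW k0k)) dN.
apply: leq_trans (leq_mul (leqnn E) (unsolvable_count_le alphaA mc dK)) _.
have : (2 * E * m * (N %/ M) <= N)%N.
  by apply: leq_trans (leq_trunc_div N M); rewrite mulnC leq_mul2l leqnSn orbT.
nia.
Unshelve. all: by end_near. Qed.
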